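(* Let $f:\mathbb{R}^n\to\mathbb{R}$ be a smooth function with minimum value $f^*$ such that, for constants $\ell_f,L_f\ge0$ and $\mu_f>0$ and all $x\in\mathbb{R}^n$, $$-\ell_f I_n\preceq\nabla^2 f(x)\preceq L_f I_n,\qquad \tfrac12\|\nabla f(x)\|^2\ge\mu_f\,(f(x)-f^* ).$$ Let $i\in\{\mathbf I,\mathbf{II}\}$. The solution trajectory $x^k=(x_1^k,x_2^k)$ of the discrete-time hybrid control system of structure $i$ with step size $s$ (defined in the context), starting from any initial condition $x_1^0$, satisfies $$f(x_1^{k+1})-f^*\le\lambda(s,c_1,c_2,\beta)\,\big(f(x_1^k)-f^*\big),$$ with $\lambda(s,c_1,c_2,\beta)\in(0,1)$ given by $$\lambda(s,c_1,c_2,\beta):=1+2\mu_f\Big(-\frac{s}{c_2}+\frac{L_f}{2c_1}s^2\Big),$$ if the parameters $s,c_1,c_2,\beta$ satisfy $$\sqrt{c_1}\le c_2,\qquad \beta^2c_1\le1\le\beta c_2,\qquad c_2L_fs<2c_1.$$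
   Context: The function $f$ is twice differentiable; $\|\cdot\|$ is the Euclidean norm and $\langle\cdot,\cdot\rangle$ the Euclidean inner product. $\alpha$ is a given positive scalar, $s$ is the time-discretization step size, and $c_1,c_2$ are positive scalars. Discrete-time hybrid control system of structure $i\in\{\mathbf I,\mathbf{II}\}$ (forward-Euler discretization): the state is $x^k=(x_1^k,x_2^k)\in\mathbb{R}^n\times\mathbb{R}^n$ and $$x^{k+1}=\begin{cases}x^k+s\,F_i\big(x^k,u_i(x^k)\big),&x^k\in\mathcal{C}_{d,i},\\ \big(x_1^k,\,-\beta\nabla f(x_1^k)\big),&\text{otherwise},\end{cases}$$ with flow set $$\mathcal{C}_{d,i}=\big\{(x_1,x_2)\in\mathbb{R}^{2n}:\ c_1\|x_2\|^2\le\|\nabla f(x_1)\|^2\le c_2\langle\nabla f(x_1),-x_2\rangle\big\}.$$ The maps are $$F_{\mathbf I}(x,u)=\big(x_2,\,-\nabla f(x_1)-u\,x_2\big),\qquad u_{\mathbf I}(x)=\alpha+\frac{\|\nabla f(x_1)\|^2-\langle\nabla^2f(x_1)x_2,x_2\rangle}{\langle\nabla f(x_1),-x_2\rangle},$$ $$F_{\mathbf{II}}(x,u)=\big(x_2,\,-x_2-u\,\nabla f(x_1)\big),\qquad u_{\mathbf{II}}(x)=\frac{\langle\nabla^2f(x_1)x_2,x_2\rangle+(1-\alpha)\langle\nabla f(x_1),-x_2\rangle}{\|\nabla f(x_1)\|^2}.$$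
   Formalization: The inequality is stated for steps with x^k in the flow set; at a jump x_1^{k+1}=x_1^k, x^{k+1} is in the flow set and the bound holds from k to k+2. λ<1 always; for nonconstant f, λ≥0, with λ=0 iff μ_f=L_f, c_1=c_2², L_f s=c_2. *)

(* Defs.v *)
From HB Require Import structures.
From mathcomp Require Import all_boot all_order all_algebra.
From mathcomp Require Import all_classical all_reals all_analysis.
Set Implicit Arguments.
Unset Strict Implicit.
Unset Printing Implicit Defensive.
Import Order.TTheory GRing.Theory Num.Theory.
Import numFieldNormedType.Exports.
Local Open Scope ring_scope.

Definition dotv (R : realType) (n : nat) (u v : 'rV[R]_n) : R :=
  \sum_(i < n) u 0 i * v 0 i.

(* The library norm `|u| on 'rV[R]_n is the sup norm, hence this definition. *)
Definition enorm (R : realType) (n : nat) (u : 'rV[R]_n) : R :=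
  Num.sqrt (dotv u u).

Definition gradient (R : realType) (n : nat) (f : 'rV[R]_n -> R)
    (x : 'rV[R]_n) : 'rV[R]_n :=
  \row_j 'D_(delta_mx 0 j) f x.

(* Vectors are rows: the Hessian applied to v is v *m hessian f x. *)
Definition hessian (R : realType) (n : nat) (f : 'rV[R]_n -> R)
    (x : 'rV[R]_n) : 'M[R]_n :=
  jacobian (gradient f) x.

Definition twice_differentiable (R : realType) (n : nat)
    (f : 'rV[R]_n -> R) : Prop :=
  (forall x, differentiable f x) /\ (forall x, differentiable (gradient f) x).

(* A \preceq B in the Loewner order: B - A is positive semidefinite. *)
Definition loewner_le (R : realType) (n : nat) (A B : 'M[R]_n) : Prop :=
  forall v : 'rV[R]_n, 0 <= dotv (v *m (B - A)) v.

Definition is_min_value (R : realType) (T : Type) (f : T -> R) (m : R) : Prop :=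
  (exists x, f x = m) /\ (forall x, m <= f x).

Inductive structure : Set := StructI | StructII.

Section HybridSystem.
Variables (R : realType) (n : nat) (f : 'rV[R]_n -> R).
Variables (alpha s c1 c2 beta : R).

Definition state : Type := ('rV[R]_n * 'rV[R]_n)%type.

Definition flow_map (i : structure) (x : state) (u : R) : state :=
  match i with
  | StructI => (x.2, - gradient f x.1 - u *: x.2)
  | StructII => (x.2, - x.2 - u *: gradient f x.1)
  end.

(* Division by 0 yields 0 here. Inside the flow set the denominators vanish
   only when gradient f x.1 = 0 and x.2 = 0 (for c1 > 0), and then the value
   of the feedback has no effect on flow_map. *)
Definition feedback (i : structure) (x : state) : R :=
  let g := gradient f x.1 in
  let curv := dotv (x.2 *m hessian f x.1) x.2 in
  match i with
  | StructI => alpha + (enorm g ^+ 2 - curv) / dotv g (- x.2)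
  | StructII => (curv + (1 - alpha) * dotv g (- x.2)) / enorm g ^+ 2
  end.

Definition in_flow_set (x : state) : bool :=
  let g := gradient f x.1 in
  (c1 * enorm x.2 ^+ 2 <= enorm g ^+ 2) && (enorm g ^+ 2 <= c2 * dotv g (- x.2)).

Definition jump_map (x : state) : state := (x.1, - (beta *: gradient f x.1)).

Definition hybrid_step (i : structure) (x : state) : state :=
  if in_flow_set x then
    let F := flow_map i x (feedback i x) in (x.1 + s *: F.1, x.2 + s *: F.2)
  else jump_map x.

Definition is_trajectory (i : structure) (x : nat -> state) : Prop :=
  forall k, x k.+1 = hybrid_step i (x k).

End HybridSystem.

Definition contraction_rate (R : realType) (mu L s c1 c2 : R) : R :=
  1 + 2 * mu * (- (s / c2) + L / (2 * c1) * s ^+ 2).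

(* Main.v *)
Require Import Defs.
From mathcomp Require Import all_boot all_order all_algebra.
From mathcomp Require Import all_classical all_reals all_analysis.
From mathcomp Require Import ring lra.
Import Order.TTheory GRing.Theory Num.Theory.
Import numFieldNormedType.Exports.
Local Open Scope ring_scope.

(* Along the segment from x to x + v the function f has second derivative at most
   L |v|^2, which gives the quadratic upper bound
   f (x + v) <= f x + <grad f x, v> + L/2 |v|^2.
   At a flow step v = s x_2, and the two inequalities defining the flow set turn
   this bound into f x - (s/c2 - L s^2/(2 c1)) |grad f x|^2; the
   Polyak-Lojasiewicz inequality then gives the contraction. For the sign of
   the rate, minimizing the quadratic bound along -grad f forces mu <= L unless f
   is constant, and the rate is a quadratic in s dominating (1 - mu s/c2)^2. *)

(** * Bilinearity of the Euclidean inner product *)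

Section EuclideanProduct.
Variables (R : realType) (n : nat).
Implicit Types (u v w : 'rV[R]_n) (a : R).

Lemma dotv_mulmx u v : dotv u v = (u *m v^T) 0 0.
Proof. by rewrite mxE; apply: eq_bigr => i _; rewrite mxE. Qed.

Lemma dotvBl u v w : dotv (u - v) w = dotv u w - dotv v w.
Proof. by rewrite !dotv_mulmx mulmxBl !mxE. Qed.

Lemma dotvZl a u v : dotv (a *: u) v = a * dotv u v.
Proof. by rewrite !dotv_mulmx -scalemxAl mxE. Qed.

Lemma dotvZr a u v : dotv u (a *: v) = a * dotv u v.
Proof. by rewrite !dotv_mulmx linearZ /= -scalemxAr mxE. Qed.

Lemma dotvNr u v : dotv u (- v) = - dotv u v.
Proof. by rewrite -scaleN1r dotvZr mulN1r. Qed.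

Lemma dotvv_ge0 u : 0 <= dotv u u.
Proof. by apply: sumr_ge0 => i _; rewrite -expr2 sqr_ge0. Qed.

Lemma sqr_enorm u : enorm u ^+ 2 = dotv u u.
Proof. by rewrite sqr_sqrtr ?dotvv_ge0. Qed.

End EuclideanProduct.

(** * Calculus in one real variable and along lines *)

Lemma nonincreasing_of_is_derive (R : realType) (h dh : R -> R) :
  (forall t : R, is_derive t 1 h (dh t)) ->
  (forall t, 0 <= t -> dh t <= 0) -> forall t, 0 <= t -> h t <= h 0.
Proof.
move=> hd dh_le0 t t_ge0; rewrite -subr_le0.
have hcont : {within `[0, t], continuous h}%classic.
  by apply: derivable_within_continuous => y _; case: (hd y).
have [c /[!in_itv]/= /andP[c_ge0 _] ->] := MVT_segment t_ge0 (fun y _ => hd y) hcont.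
by rewrite mulr_le0_ge0 ?dh_le0 ?subr0.
Qed.

(** Two monotonicity arguments replace integration, so nothing is asked of [r] beyond its upper
    bound: first [q t - M * t], then [p t - q 0 * t - M / 2 * t ^+ 2], is nonincreasing for t >=
    0. *)
Lemma taylor2_le (R : realType) (p q r : R -> R) (M : R) :
  (forall t : R, is_derive t 1 p (q t)) -> (forall t : R, is_derive t 1 q (r t)) ->
  (forall t, r t <= M) -> p 1 <= p 0 + q 0 + M / 2.
Proof.
move=> dp dq rM.
have q_le t : 0 <= t -> q t <= q 0 + M * t.
  move=> t_ge0.
  suff : q t - M * t <= q 0 - M * 0 by lra.
  apply: (@nonincreasing_of_is_derive _ (fun t => q t - M * t)
    (fun t => r t - M *: 1)) => //.
  by move=> y _; rewrite [_ *: _]mulr1 subr_le0.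
have : p 1 - q 0 * 1 - M / 2 * 1 ^+ 2 <= p 0 - q 0 * 0 - M / 2 * 0 ^+ 2.
  (* The derivative is spelt in the unsimplified form that the differentiation rules return. *)
  apply: (@nonincreasing_of_is_derive _
    (fun t => p t - q 0 * t - M / 2 * t ^+ 2)
    (fun t => q t - q 0 *: 1 - (M / 2) *: ((2%:R * t ^+ 1) *: 1))) => //.
    move=> t; exact: (is_deriveB (is_deriveB (dp t)
      (is_deriveZ (q 0) (is_derive_id t 1)))
      (is_deriveZ (M / 2) (is_deriveX 2 (is_derive_id t 1)))).
  by move=> t /q_le; rewrite !/(_ *: _)/=; lra.
by rewrite !expr2; lra.
Qed.

(** The difference quotient of g along the line at time t is literally that of g at x + t v in
    direction v. *)
Lemma is_derive_line (R : realType) (V W : normedModType R) (g : V -> W)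
    (x v : V) (t : R) :
  derivable g (x + t *: v) v ->
  is_derive t 1 (fun t : R => g (x + t *: v)) ('D_v g (x + t *: v)).
Proof.
have quotE : (fun h : R => h^-1 *: (g (x + (h *: 1 + t) *: v) - g (x + t *: v)))
    = (fun h : R => h^-1 *: (g (h *: v + (x + t *: v)) - g (x + t *: v))).
  apply/funext => h.
  by rewrite [h *: 1]mulr1 scalerDl addrCA.
move=> gd; apply: DeriveDef.
  by rewrite /derivable /= quotE.
by rewrite /derive /= quotE.
Qed.

(** * Consequences of the Hessian bound *)

Section SmoothFunction.
Variables (R : realType) (n : nat) (f : 'rV[R]_n -> R).
Hypothesis f_smooth : twice_differentiable f.

Lemma derive_dotv_gradient (x v : 'rV[R]_n) : 'D_v f x = dotv (gradient f x) v.
Proof.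
have [df _] := f_smooth.
rewrite deriveE // {1}(row_sum_delta v) linear_sum.
by apply: eq_bigr => i _; rewrite linearZ mxE deriveE // mulrC.
Qed.

Lemma is_derive_dotv_gradient_line (x v : 'rV[R]_n) (t : R) :
  is_derive t 1 (fun t : R => dotv (gradient f (x + t *: v)) v)
    (dotv (v *m hessian f (x + t *: v)) v).
Proof.
have [_ dg] := f_smooth.
have Dg : derivable (gradient f) (x + t *: v) v by exact: diff_derivable.
rewrite -deriveEjacobian // derive_mx //.
(* As a combination of the scalar components of the gradient with constant coefficients, the product
   can be differentiated term by term. *)
have -> : (fun t : R => dotv (gradient f (x + t *: v)) v) =
    \sum_(i < n) (v 0 i \*: (fun t : R => gradient f (x + t *: v) 0 i)).
  by apply/funext => y; rewrite fct_sumE; apply: eq_bigr => i _; rewrite mulrC.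
under [X in is_derive _ _ _ X]eq_bigr do rewrite mxE mulrC.
apply: is_derive_sum => i; apply: is_deriveZ.
apply: (@is_derive_line _ _ _ (fun y => gradient f y 0 i)).
by have /derivable_mxP := Dg.
Qed.

Lemma smooth_upper_bound (L : R) :
  (forall x, loewner_le (hessian f x) L%:M) -> forall x v,
  f (x + v) <= f x + dotv (gradient f x) v + L * dotv v v / 2.
Proof.
move=> hess_le x v.
have := @taylor2_le R (fun t => f (x + t *: v))
  (fun t => dotv (gradient f (x + t *: v)) v)
  (fun t => dotv (v *m hessian f (x + t *: v)) v) (L * dotv v v).
rewrite scale1r !scale0r addr0; apply.
- move=> t; rewrite -derive_dotv_gradient; apply: is_derive_line.
  by apply: diff_derivable; have [+ _] := f_smooth.
- by move=> t; exact: is_derive_dotv_gradient_line.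
- move=> t; have := hess_le (x + t *: v) v.
  by rewrite mulmxBr dotvBl mul_mx_scalar dotvZl subr_ge0.
Qed.

Lemma PL_constant_le (fstar L mu : R) :
  (forall x, fstar <= f x) -> 0 <= L ->
  (forall x, loewner_le (hessian f x) L%:M) ->
  (forall x, 2^-1 * enorm (gradient f x) ^+ 2 >= mu * (f x - fstar)) ->
  0 < mu -> (exists y, f y <> fstar) -> mu <= L.
Proof.
move=> f_ge L_ge0 hess_le PL mu_gt0 [y /eqP fy_neq].
have gap_gt0 : 0 < f y - fstar by rewrite subr_gt0 lt_neqAle eq_sym fy_neq f_ge.
have := PL y; rewrite sqr_enorm; set G := dotv _ _ => PLy.
have G_gt0 : 0 < G by have := mulr_gt0 mu_gt0 gap_gt0; lra.
have desc t : fstar <= f y - t * G + L * t ^+ 2 * G / 2.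
  apply: le_trans (f_ge _) (le_trans (smooth_upper_bound _ hess_le y
    (- t *: gradient f y)) _).
  by rewrite !dotvZl !dotvZr -/G; lra.
have [L_eq0|L_neq0] := eqVneq L 0.
  (* For L = 0 the bound is affine in t; this t brings it down to [fstar - 1], a contradiction. *)
  have := desc ((f y - fstar + 1) / G).
  by rewrite L_eq0 divfK ?gt_eqF //; lra.
have L_gt0 : 0 < L by rewrite lt_neqAle eq_sym L_neq0.
(* The minimizer of the quadratic bound in t. It gives G / (2 L) <= f y - fstar, to be compared with
   the lower bound on G in [PLy]. *)
have := desc L^-1.
have -> : L * L^-1 ^+ 2 * G / 2 = L^-1 * G / 2 by field.
move=> descL.
have : L^-1 * G / 2 <= f y - fstar by lra.
have -> : L^-1 * G / 2 = (2^-1 * G) / L by field.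
rewrite ler_pdivrMr // => GL.
by rewrite -(ler_pM2r gap_gt0); lra.
Qed.

End SmoothFunction.

(** * Size of the contraction rate *)

Lemma contraction_rate_lt1 (R : realType) (mu L s c1 c2 : R) :
  0 < mu -> 0 < s -> 0 < c1 -> 0 < c2 -> c2 * L * s < 2 * c1 ->
  contraction_rate mu L s c1 c2 < 1.
Proof.
move=> mu_gt0 s_gt0 c1_gt0 c2_gt0 step.
have -> : contraction_rate mu L s c1 c2 =
    1 - mu * s * (2 * c1 - c2 * L * s) / (c1 * c2).
  by rewrite /contraction_rate; field; rewrite !gt_eqF.
by rewrite ltrBlDr ltrDl divr_gt0 ?mulr_gt0 // subr_gt0.
Qed.

Lemma contraction_rate_sqrE (R : realType) (mu L s c1 c2 : R) :
  c1 != 0 -> c2 != 0 ->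
  contraction_rate mu L s c1 c2 =
    (1 - mu * s / c2) ^+ 2 + mu * s ^+ 2 * (L * c2 ^+ 2 - mu * c1) / (c1 * c2 ^+ 2).
Proof.
move=> c1_neq0 c2_neq0; rewrite /contraction_rate; field.
by rewrite c1_neq0 c2_neq0.
Qed.

Lemma contraction_rate_ge0 (R : realType) (mu L s c1 c2 : R) :
  0 < mu -> mu <= L -> 0 < s -> 0 < c1 -> 0 < c2 -> c1 <= c2 ^+ 2 ->
  0 <= contraction_rate mu L s c1 c2 /\
  (contraction_rate mu L s c1 c2 = 0 <-> [/\ mu = L, c1 = c2 ^+ 2 & L * s = c2]).
Proof.
move=> mu_gt0 muL s_gt0 c1_gt0 c2_gt0 c1c2.
have L_gt0 := lt_le_trans mu_gt0 muL.
(* [d1] and [d2] add up to the numerator [L * c2 ^+ 2 - mu * c1] of the remainder, so it is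
   nonnegative and vanishes only if both do. *)
have d1 : 0 <= (L - mu) * c2 ^+ 2.
  by apply: mulr_ge0; [rewrite subr_ge0 | exact: sqr_ge0].
have d2 : 0 <= mu * (c2 ^+ 2 - c1).
  by apply: mulr_ge0; [exact: ltW | rewrite subr_ge0].
have rem_ge0 : 0 <= mu * s ^+ 2 * (L * c2 ^+ 2 - mu * c1) / (c1 * c2 ^+ 2).
  have D_ge0 : 0 <= L * c2 ^+ 2 - mu * c1 by lra.
  by rewrite divr_ge0 // !mulr_ge0 ?sqr_ge0 // ltW.
rewrite contraction_rate_sqrE ?gt_eqF //; split.
  by apply: addr_ge0 => //; exact: sqr_ge0.
split=> [/eqP|[-> -> Ls]]; last first.
  by rewrite Ls divff ?gt_eqF // !subrr mulr0 mul0r expr0n addr0.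
rewrite paddr_eq0 ?sqr_ge0 // sqrf_eq0 subr_eq0 => /andP[/eqP mus /eqP rem0].
have {}mus : mu * s = c2.
  by rewrite -[RHS]mul1r mus divfK ?gt_eqF.
have den : L * c2 ^+ 2 - mu * c1 = 0.
  apply/eqP; move/eqP: rem0.
  rewrite !mulf_eq0 invr_eq0 mulf_eq0 !expf_eq0 /= (gt_eqF mu_gt0).
  by rewrite (gt_eqF s_gt0) (gt_eqF c1_gt0) (gt_eqF c2_gt0) !orbF.
have muLE : mu = L.
  have /eqP : (L - mu) * c2 ^+ 2 = 0 by lra.
  by rewrite mulf_eq0 expf_eq0 /= (gt_eqF c2_gt0) orbF subr_eq0 => /eqP.
have c1E : c1 = c2 ^+ 2.
  have /eqP : mu * (c2 ^+ 2 - c1) = 0 by lra.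
  by rewrite mulf_eq0 (gt_eqF mu_gt0) subr_eq0 => /eqP.
by rewrite -muLE.
Qed.

(** * Flow steps and jumps of the hybrid system *)

Section HybridSteps.
Variables (R : realType) (n : nat) (f : 'rV[R]_n -> R).
Variables (alpha s c1 c2 beta : R) (i : structure).
Implicit Type x : state R n.

(** Both structures move x_1 with velocity x_2, which allows a single estimate to serve for the
    two. *)
Lemma hybrid_step_fst x :
  in_flow_set f c1 c2 x ->
  (hybrid_step f alpha s c1 c2 beta i x).1 = x.1 + s *: x.2.
Proof. by rewrite /hybrid_step => ->; case: i. Qed.

(** With x_2 = -beta grad f, the two flow inequalities are the two conditions on beta multiplied by
    |grad f|^2. *)
Lemma jump_map_in_flow_set x :
  beta ^+ 2 * c1 <= 1 -> 1 <= beta * c2 ->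
  in_flow_set f c1 c2 (jump_map f beta x).
Proof.
move=> beta_lo beta_hi; rewrite /in_flow_set /= opprK !sqr_enorm -scaleNr.
have := dotvv_ge0 _ _ (gradient f x.1).
rewrite !dotvZl !dotvZr; set G := dotv _ _ => G_ge0.
have lo := ler_wpM2r G_ge0 beta_lo; have hi := ler_wpM2r G_ge0 beta_hi.
by apply/andP; split; lra.
Qed.

Lemma flow_step_contraction (fstar L mu : R) x :
  twice_differentiable f -> 0 <= L ->
  (forall y, loewner_le (hessian f y) L%:M) ->
  mu * (f x.1 - fstar) <= 2^-1 * enorm (gradient f x.1) ^+ 2 ->
  0 < s -> 0 < c1 -> 0 < c2 -> c2 * L * s < 2 * c1 ->
  in_flow_set f c1 c2 x ->
  f (hybrid_step f alpha s c1 c2 beta i x).1 - fstar <=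
    contraction_rate mu L s c1 c2 * (f x.1 - fstar).
Proof.
move=> f_smooth L_ge0 hess_le PLx s_gt0 c1_gt0 c2_gt0 step xC.
rewrite hybrid_step_fst //.
move: xC PLx; rewrite /in_flow_set !sqr_enorm dotvNr.
have := smooth_upper_bound _ _ _ f_smooth _ hess_le x.1 (s *: x.2).
rewrite !dotvZl !dotvZr.
set G := dotv (gradient f x.1) (gradient f x.1).
set P := dotv _ x.2; set Q := dotv x.2 x.2 => ub /andP[xlo xhi] PLx.
have Plo : G / c2 <= - P by rewrite ler_pdivrMr // mulrC.
have Qhi : Q <= G / c1 by rewrite ler_pdivlMr // mulrC.
have sP := ler_wpM2l (ltW s_gt0) Plo.
have Ls_ge0 : 0 <= L * s ^+ 2 / 2.
  by have := mulr_ge0 L_ge0 (sqr_ge0 s); lra.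
have LQ := ler_wpM2l Ls_ge0 Qhi.
(* The guaranteed decrease per unit of |grad f|^2. The step size condition makes it nonnegative, so
   the inequality [PLx] can be multiplied by it. *)
set kappa := s / c2 - L / (2 * c1) * s ^+ 2.
have kappa_ge0 : 0 <= kappa.
  have -> : kappa = s * (2 * c1 - c2 * L * s) / (2 * c1 * c2).
    by rewrite /kappa; field; rewrite !gt_eqF.
  by rewrite ltW // divr_gt0 ?mulr_gt0 ?subr_gt0.
have kPL := ler_wpM2l kappa_ge0 PLx.
have decrease : f (x.1 + s *: x.2) <= f x.1 - kappa * G.
  have -> : kappa * G = s * (G / c2) - L * s ^+ 2 / 2 * (G / c1).
    by rewrite /kappa; field; rewrite !gt_eqF.
  by lra.
have -> : contraction_rate mu L s c1 c2 = 1 - 2 * mu * kappa.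
  by rewrite /contraction_rate /kappa; ring.
by lra.
Qed.

End HybridSteps.

(* A jump keeps x_1, so it cannot contract f(x_1) - fstar: at a jump the decrease
   is the one over the pair of steps k -> k+2, the second of which is a flow
   step. The rate is < 1 always; it is in (0,1) for nonconstant f except at
   the one parameter choice where it is 0. *)
Theorem theorem3p11 (R : realType) (n : nat) (f : 'rV[R]_n -> R)
    (fstar ell L mu alpha s c1 c2 beta : R)
    (f_smooth : twice_differentiable f)
    (f_min : is_min_value f fstar)
    (ell_ge0 : 0 <= ell) (L_ge0 : 0 <= L) (mu_gt0 : 0 < mu)
    (hess_bounds : forall x : 'rV[R]_n,
       loewner_le (- ell)%:M (hessian f x) /\ loewner_le (hessian f x) L%:M)
    (PL : forall x : 'rV[R]_n,
       2^-1 * enorm (gradient f x) ^+ 2 >= mu * (f x - fstar))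
    (alpha_gt0 : 0 < alpha) (s_gt0 : 0 < s) (c1_gt0 : 0 < c1) (c2_gt0 : 0 < c2)
    (c1c2 : Num.sqrt c1 <= c2)
    (beta_lo : beta ^+ 2 * c1 <= 1) (beta_hi : 1 <= beta * c2)
    (step_small : c2 * L * s < 2 * c1)
    (i : structure) (x : nat -> state R n)
    (x_traj : is_trajectory f alpha s c1 c2 beta i x) :
  let lambda := contraction_rate mu L s c1 c2 in
  [/\ lambda < 1,
      (exists y, f y <> fstar) ->
        0 <= lambda /\
        (lambda = 0 <-> [/\ mu = L, c1 = c2 ^+ 2 & L * s = c2]) &
      forall k : nat,
        (in_flow_set f c1 c2 (x k) ->
           f (x k.+1).1 - fstar <= lambda * (f (x k).1 - fstar)) /\
        (~~ in_flow_set f c1 c2 (x k) ->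
           [/\ (x k.+1).1 = (x k).1,
               in_flow_set f c1 c2 (x k.+1) &
               f (x k.+2).1 - fstar <= lambda * (f (x k).1 - fstar)])].
Proof.
have hess_le y : loewner_le (hessian f y) L%:M by case: (hess_bounds y).
have [_ f_ge] := f_min.
have flow k : in_flow_set f c1 c2 (x k) -> f (x k.+1).1 - fstar <=
    contraction_rate mu L s c1 c2 * (f (x k).1 - fstar).
  by move=> xkC; rewrite x_traj; apply: flow_step_contraction.
split; first exact: contraction_rate_lt1.
  move=> f_ncst; apply: contraction_rate_ge0 => //.
    exact: (PL_constant_le _ _ _ f_smooth fstar).
  by rewrite -(sqr_sqrtr (ltW c1_gt0)) lerXn2r ?nnegrE ?sqrtr_ge0 // ltW.
move=> k; split; first exact: flow.
move=> /negbTE xkJ.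
have xk1E : x k.+1 = jump_map f beta (x k) by rewrite x_traj /hybrid_step xkJ.
have xk1C : in_flow_set f c1 c2 (x k.+1).
  by rewrite xk1E; apply: jump_map_in_flow_set.
have xk1_fst : (x k.+1).1 = (x k).1 by rewrite xk1E.
by split=> //; rewrite -xk1_fst; apply: flow.
Qed.
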